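(* Let $N\ge 2$, let $\{T_k\}_{k=1}^{N}$ be a sequence of column vectors $T_k=(T_k^{(1)},T_k^{(2)},T_k^{(3)})'$ in $\mathbb{R}^3$, and let $\mathcal{Q}_N=\{(w_k,\mathbf{x}_k)\}_{k=1}^{N}$ be a quadrature rule on $\mathbb{S}^2$, i.e. a set of $N$ pairs of real numbers $w_k$ and points $\mathbf{x}_k\in\mathbb{S}^2$. With the vector spherical harmonics $\mathbf{y}_{\ell,m},\mathbf{z}_{\ell,m}$, the scalar transform $F_{\ell,m}$ and the coefficients $\xi^{(i)}_{\ell,m},\mu^{(j)}_{\ell,m}$ defined in the context, define the discrete forward vector spherical harmonic transforms $$\widehat F_{\ell,m}(T_\cdot):=\sum_{k=1}^{N}w_k\,\mathbf{y}_{\ell,m}^{*}(\mathbf{x}_k)T_k,\qquad \widetilde F_{\ell,m}(T_\cdot):=\sum_{k=1}^{N}w_k\,\mathbf{z}_{\ell,m}^{*}(\mathbf{x}_k)T_k .$$ Then for all $\ell=1,2,\dots$ and $m=-\ell,\dots,\ell$, $$\begin{aligned} \widehat F_{\ell,m}(T_\cdot)=\frac{1}{\sqrt2}\Bigl\{&\xi^{(1)}_{\ell-1,m-1}\bigl[-F_{\ell-1,m-1}(T^{(1)}_\cdot)+\mathrm{i}\,F_{\ell-1,m-1}(T^{(2)}_\cdot)\bigr]+\xi^{(2)}_{\ell+1,m-1}\bigl[-F_{\ell+1,m-1}(T^{(1)}_\cdot)+\mathrm{i}\,F_{\ell+1,m-1}(T^{(2)}_\cdot)\bigr]\\ &+\xi^{(3)}_{\ell-1,m+1}\bigl[F_{\ell-1,m+1}(T^{(1)}_\cdot)+\mathrm{i}\,F_{\ell-1,m+1}(T^{(2)}_\cdot)\bigr]+\xi^{(4)}_{\ell+1,m+1}\bigl[F_{\ell+1,m+1}(T^{(1)}_\cdot)+\mathrm{i}\,F_{\ell+1,m+1}(T^{(2)}_\cdot)\bigr]\Bigr\}\\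 &+\xi^{(5)}_{\ell-1,m}F_{\ell-1,m}(T^{(3)}_\cdot)+\xi^{(6)}_{\ell+1,m}F_{\ell+1,m}(T^{(3)}_\cdot) \end{aligned}$$ and $$\begin{aligned} \widetilde F_{\ell,m}(T_\cdot)=-\frac{1}{\sqrt2}\mathrm{i}\Bigl[&\mu^{(1)}_{\ell,m-1}\bigl(-F_{\ell,m-1}(T^{(1)}_\cdot)+\mathrm{i}\,F_{\ell,m-1}(T^{(2)}_\cdot)\bigr)+\mu^{(3)}_{\ell,m+1}\bigl(F_{\ell,m+1}(T^{(1)}_\cdot)+\mathrm{i}\,F_{\ell,m+1}(T^{(2)}_\cdot)\bigr)\Bigr]-\mathrm{i}\,\mu^{(2)}_{\ell,m}F_{\ell,m}(T^{(3)}_\cdot). \end{aligned}$$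
   Context: $\mathbb{S}^2$ is the unit sphere of $\mathbb{R}^3$; $\mathrm{i}$ is the imaginary unit; $'$ denotes transpose and $^*$ denotes complex conjugate transpose (complex conjugate for scalars). Scalar spherical harmonics. In spherical coordinates $\mathbf{x}=(\sin\theta\cos\varphi,\sin\theta\sin\varphi,\cos\theta)'$, for $\ell=0,1,\dots$, $Y_{\ell,m}(\mathbf{x})=\sqrt{\frac{2\ell+1}{4\pi}\frac{(\ell-m)!}{(\ell+m)!}}\,P_\ell^{m}(\cos\theta)e^{\mathrm{i}m\varphi}$ for $m=0,\dots,\ell$, and $Y_{\ell,m}=(-1)^m\,Y_{\ell,-m}^{*}$ for $m=-\ell,\dots,-1$, where $P_\ell^m(t)=\frac{(-1)^m}{2^\ell\ell!}(1-t^2)^{m/2}\frac{d^{\ell+m}}{dt^{\ell+m}}(t^2-1)^\ell$ is the associated Legendre function. Convention: $Y_{\ell,m}=0$ if $|m|>\ell$. Clebsch–Gordan coefficients. $C^{\ell,m}_{j_1,m_1,j_2,m_2}=(-1)^{m+j_1-j_2}\sqrt{2\ell+1}\begin{pmatrix}j_1&j_2&\ell\\ m_1&m_2&-m\end{pmatrix}$ (Wigner $3$-$j$ symbol). Those needed are, for $\ell\ge1$ and $-\ell\le m\le \ell$, $$\begin{aligned} &C^{\ell,m}_{\ell-1,m-1,1,1}=\sqrt{\tfrac{(\ell+m)(\ell+m-1)}{(2\ell)(2\ell-1)}}, && C^{\ell,m}_{\ell+1,m-1,1,1}=\sqrt{\tfrac{(\ell-m+1)(\ell-m+2)}{(2\ell+2)(2\ell+3)}},\\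 &C^{\ell,m}_{\ell-1,m,1,0}=\sqrt{\tfrac{(\ell+m)(\ell-m)}{\ell(2\ell-1)}}, && C^{\ell,m}_{\ell+1,m,1,0}=-\sqrt{\tfrac{(\ell-m+1)(\ell+m+1)}{(2\ell+3)(\ell+1)}},\\ &C^{\ell,m}_{\ell-1,m+1,1,-1}=\sqrt{\tfrac{(\ell-m)(\ell-m-1)}{(2\ell)(2\ell-1)}}, && C^{\ell,m}_{\ell+1,m+1,1,-1}=\sqrt{\tfrac{(\ell+m+1)(\ell+m+2)}{(2\ell+3)(2\ell+2)}},\\ &C^{\ell,m}_{\ell,m-1,1,1}=-\sqrt{\tfrac{(\ell+m)(\ell-m+1)}{\ell(2\ell+2)}}, && C^{\ell,m}_{\ell,m+1,1,-1}=\sqrt{\tfrac{(\ell+m+1)(\ell-m)}{\ell(2\ell+2)}},\qquad C^{\ell,m}_{\ell,m,1,0}=\tfrac{m}{\sqrt{\ell(\ell+1)}}. \end{aligned}$$ Let $c_\ell=\sqrt{\frac{\ell+1}{2\ell+1}}$ and $d_\ell=\sqrt{\frac{\ell}{2\ell+1}}$. Vector spherical harmonics. For $\ell\ge1$, $-\ell\le m\le\ell$, let $$\begin{aligned} B_{+1,\ell,m}&=c_\ell C^{\ell,m}_{\ell-1,m-1,1,1}Y_{\ell-1,m-1}+d_\ell C^{\ell,m}_{\ell+1,m-1,1,1}Y_{\ell+1,m-1},\\ B_{0,\ell,m}&=c_\ell C^{\ell,m}_{\ell-1,m,1,0}Y_{\ell-1,m}+d_\ell C^{\ell,m}_{\ell+1,m,1,0}Y_{\ell+1,m},\\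 B_{-1,\ell,m}&=c_\ell C^{\ell,m}_{\ell-1,m+1,1,-1}Y_{\ell-1,m+1}+d_\ell C^{\ell,m}_{\ell+1,m+1,1,-1}Y_{\ell+1,m+1},\\ D_{+1,\ell,m}&=\mathrm{i}\,C^{\ell,m}_{\ell,m-1,1,1}Y_{\ell,m-1},\quad D_{0,\ell,m}=\mathrm{i}\,C^{\ell,m}_{\ell,m,1,0}Y_{\ell,m},\quad D_{-1,\ell,m}=\mathrm{i}\,C^{\ell,m}_{\ell,m+1,1,-1}Y_{\ell,m+1}. \end{aligned}$$ The (so-called divergence-free and curl-free) vector spherical harmonics are the column-vector-valued functions $\mathbb{S}^2\to\mathbb{C}^3$ $$\mathbf{y}_{\ell,m}=\begin{pmatrix} -\frac1{\sqrt2}(B_{+1,\ell,m}-B_{-1,\ell,m}) \\ -\frac1{\sqrt2}\mathrm{i}(B_{+1,\ell,m}+B_{-1,\ell,m}) \\ {B_{0,\ell,m}} \end{pmatrix},\qquad \mathbf{z}_{\ell,m}=\begin{pmatrix} -\frac1{\sqrt2}(D_{+1,\ell,m}-D_{-1,\ell,m}) \\ -\frac1{\sqrt2}\mathrm{i}(D_{+1,\ell,m}+D_{-1,\ell,m}) \\ {D_{0,\ell,m}} \end{pmatrix}.$$ Discrete forward scalar spherical harmonic transform. For a real sequence $f_\cdot=\{f_k\}_{k=1}^N$, $F_{\ell,m}(f_\cdot)=\sum_{k=1}^N w_kf_kY_{\ell,m}^*(\mathbf{x}_k)$ for $\ell\ge0$ and integer $m$ (so $F_{\ell,m}=0$ if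 $|m|>\ell$). For $i=1,2,3$, $T^{(i)}_\cdot=\{T^{(i)}_k\}_{k=1}^N$. Coefficients. $\xi^{(1)}_{\ell,m}=c_{\ell+1}C^{\ell+1,m+1}_{\ell,m,1,1}$, $\xi^{(2)}_{\ell,m}=d_{\ell-1}C^{\ell-1,m+1}_{\ell,m,1,1}$, $\xi^{(3)}_{\ell,m}=c_{\ell+1}C^{\ell+1,m-1}_{\ell,m,1,-1}$, $\xi^{(4)}_{\ell,m}=d_{\ell-1}C^{\ell-1,m-1}_{\ell,m,1,-1}$, $\xi^{(5)}_{\ell,m}=c_{\ell+1}C^{\ell+1,m}_{\ell,m,1,0}$, $\xi^{(6)}_{\ell,m}=d_{\ell-1}C^{\ell-1,m}_{\ell,m,1,0}$; $\mu^{(1)}_{\ell,m}=C^{\ell,m+1}_{\ell,m,1,1}$, $\mu^{(2)}_{\ell,m}=C^{\ell,m}_{\ell,m,1,0}$, $\mu^{(3)}_{\ell,m}=C^{\ell,m-1}_{\ell,m,1,-1}$. *)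

(* Defs.v *)
From mathcomp Require Import all_boot all_order all_algebra.
From mathcomp Require Import all_classical all_reals all_analysis.
From mathcomp Require Import complex.
From mathcomp Require Import ring lra zify.

Set Implicit Arguments.
Unset Strict Implicit.
Unset Printing Implicit Defensive.

Import Order.TTheory GRing.Theory Num.Theory.

(* [ring_scope] is opened last: ['i] and [^*] are those of [numClosedFieldType],
   and [^t*] is the conjugate transpose of a matrix. *)
Local Open Scope complex_scope.
Local Open Scope sesquilinear_scope.
Local Open Scope ring_scope.

Definition sphere (R : realType) (x : 'cV[R]_3) : Prop :=
  \sum_(i < 3) x i 0 ^+ 2 = 1.

Record quadrature (R : realType) (N : nat) := Quadrature {
  weight : 'I_N -> R;
  node : 'I_N -> 'cV[R]_3;
  node_sphere : forall k, sphere (node k) }.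

Definition col3 (T : Type) (a b c : T) : 'cV[T]_3 :=
  \col_(i < 3) tnth [tuple a; b; c] i.

Definition spherical (R : realType) (theta phi : R) : 'cV[R]_3 :=
  col3 (sin theta * cos phi) (sin theta * sin phi) (cos theta).

Definition colatitude (R : realType) (x : 'cV[R]_3) : R := acos (x 2 0).

(* At the poles the quotient is [0 / 0 = 0], so the azimuth is [pi / 2] there. *)
Definition azimuth (R : realType) (x : 'cV[R]_3) : R :=
  let a := acos (x 0 0 / Num.sqrt (x 0 0 ^+ 2 + x 1 0 ^+ 2)) in
  if 0 <= x 1 0 then a else 2 * pi - a.

Lemma spherical_coordinates (R : realType) (x : 'cV[R]_3) :
  sphere x -> spherical (colatitude x) (azimuth x) = x.
Proof.
rewrite /sphere !big_ord_recl big_ord0 addr0.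
have -> : lift ord0 (ord0 : 'I_2) = 1 by apply/val_inj.
have -> : lift ord0 (lift ord0 (ord0 : 'I_1)) = 2 :> 'I_3 by apply/val_inj.
have -> : ord0 = 0 :> 'I_3 by [].
rewrite /spherical /colatitude /azimuth => abc.
suff: [/\ sin (acos (x 2 0)) * cos (azimuth x) = x 0 0,
          sin (acos (x 2 0)) * sin (azimuth x) = x 1 0
        & cos (acos (x 2 0)) = x 2 0].
  case=> e0 e1 e2; apply/colP => -[[|[|[|//]]] Hi]; rewrite mxE.
  - by rewrite [LHS]e0; congr (x _ _); apply/val_inj.
  - by rewrite [LHS]e1; congr (x _ _); apply/val_inj.
  - by rewrite [LHS]e2; congr (x _ _); apply/val_inj.
rewrite /azimuth; move: abc.
move: (x 0 0) (x 1 0) (x 2 0) => a b c abc.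
set r := Num.sqrt (a ^+ 2 + b ^+ 2).
have ab0 : 0 <= a ^+ 2 + b ^+ 2 by rewrite addr_ge0 ?sqr_ge0.
have r2 : r ^+ 2 = a ^+ 2 + b ^+ 2 by rewrite sqr_sqrtr.
have r0 : 0 <= r by exact: sqrtr_ge0.
have c1 : -1 <= c <= 1 by apply/andP; split; nra.
have -> : sin (acos c) = r by rewrite sin_acos// /r; congr Num.sqrt; lra.
rewrite acosK ?in_itv//.
have [rz|rnz] := eqVneq r 0.
  rewrite rz !mul0r; move: r2; rewrite rz expr0n/= => r2.
  by split=> //; nra.
have rp : 0 < r by rewrite lt_neqAle eq_sym rnz.
have ar : -1 <= a / r <= 1.
  by rewrite ler_pdivlMr// ler_pdivrMr//; apply/andP; split; nra.
have rcos : r * cos (acos (a / r)) = a.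
  by rewrite acosK ?in_itv// mulrC divfK.
have rsin : r * sin (acos (a / r)) = `|b|.
  rewrite sin_acos// -[X in X * _ = _](ger0_norm r0) -sqrtr_sqr -sqrtrM ?sqr_ge0//.
  rewrite mulrBr mulr1 expr_div_n mulrC divfK ?sqrf_eq0// r2 addrC addKr.
  by rewrite sqrtr_sqr.
case: ifPn => [b0|]; first by rewrite rcos rsin ger0_norm.
rewrite -ltNge => b0; rewrite mulr_natl cosB sinB.
rewrite cos2pi sin2pi !mul1r !mul0r addr0 sub0r mulrN rcos rsin.
by rewrite ltr0_norm// opprK.
Qed.

(* [1 / z!], with the convention that it vanishes on negative integers. *)
Definition inv_fact (R : realType) (z : int) : R :=
  match z with Posz n => n`!%:R^-1 | Negz _ => 0 end.

Definition triangle (j1 j2 j3 : nat) : bool :=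
  [&& j1 <= j2 + j3, j2 <= j1 + j3 & j3 <= j1 + j2]%N.

Definition wigner_delta (R : realType) (j1 j2 j3 : nat) : R :=
  Num.sqrt (((j1 + j2 - j3)`! * (j1 + j3 - j2)`! * (j2 + j3 - j1)`!)%:R
            / (j1 + j2 + j3).+1`!%:R).

(* Wigner 3-j symbol with integer angular momenta, by Racah's formula. *)
Definition wigner3j (R : realType) (j1 j2 j3 : nat) (m1 m2 m3 : int) : R :=
  if [&& triangle j1 j2 j3, m1 + m2 + m3 == 0,
         `|m1| <= j1%:Z, `|m2| <= j2%:Z & `|m3| <= j3%:Z]
  then (-1) ^ (j1%:Z - j2%:Z - m3) * wigner_delta R j1 j2 j3
    * Num.sqrt ((absz (j1%:Z + m1)%R)`! * (absz (j1%:Z - m1)%R)`!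
              * (absz (j2%:Z + m2)%R)`! * (absz (j2%:Z - m2)%R)`!
              * (absz (j3%:Z + m3)%R)`! * (absz (j3%:Z - m3)%R)`!)%:R
    * \sum_(s < (j1 + j2).+1) (-1) ^+ s
        * inv_fact R s%:Z * inv_fact R (j1%:Z + j2%:Z - j3%:Z - s%:Z)
        * inv_fact R (j1%:Z - m1 - s%:Z) * inv_fact R (j2%:Z + m2 - s%:Z)
        * inv_fact R (j3%:Z - j2%:Z + m1 + s%:Z)
        * inv_fact R (j3%:Z - j1%:Z - m2 + s%:Z)
  else 0.

(* [clebsch_gordan R l m j1 m1 j2 m2] is C^{l,m}_{j1,m1,j2,m2}. *)
Definition clebsch_gordan (R : realType) (l : nat) (m : int) (j1 : nat)
    (m1 : int) (j2 : nat) (m2 : int) : R :=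
  (-1) ^ (m + j1%:Z - j2%:Z) * Num.sqrt (2 * l + 1)%:R
  * wigner3j R j1 j2 l m1 m2 (- m).

Section Table.
Variable R : realType.
Local Notation inv_fact := (inv_fact R).

Let inv_fact_lt0 (z : int) : z < 0 -> inv_fact z = 0.
Proof. by case: z. Qed.

Let inv_fact_pred (n : nat) : inv_fact (n%:Z - 1) = n%:R * inv_fact n%:Z.
Proof.
case: n => [|n]; first by rewrite mul0r.
rewrite (_ : n.+1%:Z - 1 = n%:Z); last by lia.
by rewrite /= factS natrM invfM mulrA divff ?mul1r ?pnatr_eq0.
Qed.

Let sum_ext (F : nat -> R) (n k : nat) :
  (forall s, (n <= s)%N -> F s = 0) ->
  \sum_(s < n + k) F s = \sum_(s < n) F s.
Proof.
move=> F0; rewrite big_split_ord /= [X in _ + X]big1 ?addr0// => i _.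
by rewrite F0 ?leq_addr.
Qed.

Let wterm (u p2 p1 q1 s : nat) : R :=
  (-1) ^+ s * inv_fact s%:Z * inv_fact (u%:Z - s%:Z)
    * inv_fact (q1%:Z - s%:Z) * inv_fact (p2%:Z - s%:Z)
    * inv_fact (p1%:Z - u%:Z + s%:Z) * inv_fact (2 - u%:Z - p2%:Z + s%:Z).

Let wsum (u p2 p1 q1 : nat) : R := \sum_(s < 3) wterm u p2 p1 q1 s.

Let CG1 (l : nat) (m : int) (j1 : nat) (m1 m2 : int)
    (u p1 q1 p2 q2 p3 q3 : nat) :
  triangle j1 1 l -> m1 + m2 = m -> (j1 + 1 = l + u)%N ->
  j1%:Z + m1 = p1%:Z -> j1%:Z - m1 = q1%:Z ->
  1 + m2 = p2%:Z -> 1 - m2 = q2%:Z ->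
  l%:Z + m = p3%:Z -> l%:Z - m = q3%:Z ->
  clebsch_gordan R l m j1 m1 1 m2 =
    Num.sqrt ((2 * l + 1)%:R *
      ((j1 + 1 - l)`! * (j1 + l - 1)`! * (1 + l - j1)`!)%:R
         / (j1 + 1 + l).+1`!%:R *
      (p1`! * q1`! * p2`! * q2`! * q3`! * p3`!)%:R) * wsum u p2 p1 q1.
Proof.
move=> tri mE uE p1E q1E p2E q2E p3E q3E.
rewrite /clebsch_gordan /wigner3j tri /=.
have -> : [&& m1 + m2 + - m == 0, `|m1| <= j1%:Z, `|m2| <= 1%:Z &
   `|- m| <= l%:Z] by lia.
rewrite p1E q1E p2E q2E opprK p3E q3E !absz_nat.
have -> : m + j1%:Z - 1%:Z = j1%:Z - 1%:Z + m by lia.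
set e := j1%:Z - 1%:Z + m.
have ee : (-1) ^ e * (-1) ^ e = 1 :> R.
  by rewrite -expfzMl mulrNN mulr1 exp1rz.
rewrite /wigner_delta.
set D := _ / _; set P := (_ * _)%:R; set S := \sum_(_ < _) _.
have -> : S = wsum u p2 p1 q1.
  pose F := wterm u p2 p1 q1.
  transitivity (\sum_(s < (j1 + 1).+1) F s).
    apply: eq_bigr => s _; rewrite /F /wterm.
    by congr (_ * _ * inv_fact _ * _ * _ * inv_fact _ * inv_fact _); lia.
  rewrite /wsum -(@sum_ext F _ 3); last first.
    by move=> s js; rewrite /F /wterm (inv_fact_lt0 (z := u%:Z - _)) ?(mulr0, mul0r)//; lia.
  rewrite addnC (@sum_ext F)// => s s3.
  by rewrite /F /wterm (inv_fact_lt0 (z := p2%:Z - _)) ?(mulr0, mul0r)//; lia.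
rewrite [LHS](_ : _ = ((-1) ^ e * (-1) ^ e) * 
  (Num.sqrt (2 * l + 1)%:R * Num.sqrt D * Num.sqrt P * wsum u p2 p1 q1)); last by ring.
rewrite ee mul1r -!sqrtrM ?mulr_ge0 ?ler0n ?divr_ge0 ?ler0n//.
rewrite /D /P.
by congr (Num.sqrt _ * _); rewrite mulrA.
Qed.

Let fact_neq0 (n : nat) : n`!%:R != 0 :> R.
Proof. by rewrite pnatr_eq0 -lt0n fact_gt0. Qed.

Let inv_factE (z : int) (n : nat) : z = n%:Z -> inv_fact z = n`!%:R^-1.
Proof. by move=> ->. Qed.

Let inv_fact0 (z : int) : z = 0 -> inv_fact z = 1.
Proof. by move=> ->; rewrite /= invr1. Qed.

Let inv_fact1 (z : int) : z = 1 -> inv_fact z = 1.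
Proof. by move=> ->; rewrite /= invr1. Qed.

Let inv_fact2 (z : int) : z = 2 -> inv_fact z = 2^-1.
Proof. by move=> ->. Qed.

Let inv_factP (z : int) (n : nat) : z = n%:Z - 1 ->
  inv_fact z = n%:R / n`!%:R.
Proof. by move=> ->; rewrite inv_fact_pred. Qed.

Let sum3 (F : nat -> R) : \sum_(s < 3) F s = F 0%N + F 1%N + F 2%N.
Proof. by rewrite !big_ord_recr big_ord0 /= add0r. Qed.

Local Ltac wsum_tac p q := rewrite /wsum sum3 /wterm expr0 expr1 sqrrN expr1n;
  repeat match goal with |- context [inv_fact ?z] => first
  [ rewrite (@inv_fact_lt0 z); [|lia]
  | rewrite (@inv_fact0 z); [|lia]
  | rewrite (@inv_fact1 z); [|lia]
  | rewrite (@inv_fact2 z); [|lia]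
  | rewrite (@inv_factE z p); [|lia]
  | rewrite (@inv_factE z q); [|lia]
  | rewrite (@inv_factP z p); [|lia]
  | rewrite (@inv_factP z q); [|lia]
  | generalize (inv_fact z) => ? ]
  end; field; rewrite !fact_neq0.

Let wsum02 p q : wsum 0 2 p q = (2 * p`!%:R * q`!%:R)^-1.
Proof. by wsum_tac p q. Qed.
Let wsum01 p q : wsum 0 1 p q = (p`!%:R * q`!%:R)^-1.
Proof. by wsum_tac p q. Qed.
Let wsum00 p q : wsum 0 0 p q = (2 * p`!%:R * q`!%:R)^-1.
Proof. by wsum_tac p q. Qed.
Let wsum12 p q : wsum 1 2 p q.+1 = - (p`!%:R * q`!%:R)^-1.
Proof. by wsum_tac p q. Qed.
Let wsum11 p q : wsum 1 1 p q = (p%:R - q%:R) / (p`!%:R * q`!%:R).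
Proof. by wsum_tac p q. Qed.
Let wsum10 p q : wsum 1 0 p.+1 q = (p`!%:R * q`!%:R)^-1.
Proof. by wsum_tac p q. Qed.
Let wsum22 p q : wsum 2 2 p q.+2 = (2 * p`!%:R * q`!%:R)^-1.
Proof. by wsum_tac p q. Qed.
Let wsum21 p q : wsum 2 1 p.+1 q.+1 = - (p`!%:R * q`!%:R)^-1.
Proof. by wsum_tac p q. Qed.
Let wsum20 p q : wsum 2 0 p.+2 q = (2 * p`!%:R * q`!%:R)^-1.
Proof. by wsum_tac p q. Qed.

Let dfact (l j1 : nat) : R := (2 * l + 1)%:R *
  ((j1 + 1 - l)`! * (j1 + l - 1)`! * (1 + l - j1)`!)%:R / (j1 + 1 + l).+1`!%:R.

Let dfact0 (k : nat) :
  dfact k.+1 k = 2 / (2 * k.+1%:R * (2 * k.+1%:R - 1)).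
Proof.
rewrite /dfact (_ : k + 1 - k.+1 = 0)%N; last by lia.
rewrite (_ : k + k.+1 - 1 = 2 * k)%N; last by lia.
rewrite (_ : 1 + k.+1 - k = 2)%N; last by lia.
rewrite (_ : (k + 1 + k.+1).+1 = (2 * k).+3)%N; last by lia.
rewrite fact0 (_ : 2`! = 2)%N// !factS.
have k0 : 0 <= k%:R :> R by exact: ler0n.
field; rewrite fact_neq0 /=; apply/and4P; split; lra.
Qed.

Let dfact1 (l : nat) : (0 < l)%N ->
  dfact l l = (l%:R * (2 * l%:R + 2))^-1 / 2.
Proof.
case: l => // k _.
rewrite /dfact (_ : k.+1 + 1 - k.+1 = 1)%N; last by lia.
rewrite (_ : k.+1 + k.+1 - 1 = (2 * k).+1)%N; last by lia.
rewrite (_ : 1 + k.+1 - k.+1 = 1)%N; last by lia.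
rewrite (_ : (k.+1 + 1 + k.+1).+1 = (2 * k).+4)%N; last by lia.
rewrite (_ : 1`! = 1)%N// !factS.
have k0 : 0 <= k%:R :> R by exact: ler0n.
field; rewrite fact_neq0 /=; do ?[apply/andP; split]; lra.
Qed.

Let dfact2 (l : nat) :
  dfact l l.+1 = 2 / ((2 * l%:R + 2) * (2 * l%:R + 3)).
Proof.
rewrite /dfact (_ : l.+1 + 1 - l = 2)%N; last by lia.
rewrite (_ : l.+1 + l - 1 = 2 * l)%N; last by lia.
rewrite (_ : 1 + l - l.+1 = 0)%N; last by lia.
rewrite (_ : (l.+1 + 1 + l).+1 = (2 * l).+3)%N; last by lia.
rewrite fact0 (_ : 2`! = 2)%N// !factS.
have k0 : 0 <= l%:R :> R by exact: ler0n.
field; rewrite fact_neq0 /=; do ?[apply/andP; split]; lra.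
Qed.

Let sqrtE (x y z : R) : 0 <= z -> x * z ^+ 2 = y -> Num.sqrt x * z = Num.sqrt y.
Proof.
move=> z0 <-; rewrite mulrC -[z in LHS]ger0_norm// -sqrtr_sqr -sqrtrM ?sqr_ge0//.
by rewrite mulrC.
Qed.

Let weights (l : nat) (m : int) : `|m| <= l%:Z ->
  exists a b : nat, [/\ l%:Z + m = a%:Z, l%:Z - m = b%:Z,
    l%:R + m%:~R = a%:R :> R & l%:R - m%:~R = b%:R :> R].
Proof.
move=> ml; exists (absz (l%:Z + m)), (absz (l%:Z - m)).
have aE : l%:Z + m = absz (l%:Z + m) by lia.
have bE : l%:Z - m = absz (l%:Z - m) by lia.
split => //.
- by rewrite -[RHS]/((absz (l%:Z + m))%:Z%:~R) -aE rmorphD.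
- by rewrite -[RHS]/((absz (l%:Z - m))%:Z%:~R) -bE rmorphB.
Qed.

Let cg_out (l : nat) (m : int) (j1 : nat) (m1 : int) (j2 : nat) (m2 : int) :
  `|m1| > j1%:Z -> clebsch_gordan R l m j1 m1 j2 m2 = 0.
Proof.
move=> h; rewrite /clebsch_gordan /wigner3j (leNgt `|m1|) h /=.
by rewrite !andbF mulr0.
Qed.

Local Ltac side := do ?[apply/andP; split]; rewrite ?fact_neq0 //=;
  try lra; try by rewrite gt_eqF.

Local Ltac cg_finish :=
  apply: sqrtE; [by rewrite !(mulr_ge0, invr_ge0, ler0n) |];
  rewrite ?factS ?fact0 ?muln1; field; side.

(* Racah's formula specialises to the usual closed forms for j2 = 1. *)
Lemma clebsch_gordan_pred_p1 (l : nat) (m : int) :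
  (1 <= l)%N -> `|m| <= l%:Z ->
  clebsch_gordan R l m l.-1 (m - 1) 1 1 =
  Num.sqrt ((l%:R + m%:~R) * (l%:R + m%:~R - 1)
            / ((2 * l%:R) * (2 * l%:R - 1))).
Proof.
move=> l1 ml; have [a [b [aE bE aR bR]]] := weights ml.
case: l l1 {ml} aE bE aR bR => // k _ aE bE aR bR; rewrite [k.+1.-1]/=.
case: a aE aR => [|[|a]] aE aR.
- by rewrite cg_out ?aR ?(mul0r, mulr0) ?(mul0r, mulr0) ?sqrtr0//; lia.
- by rewrite cg_out ?aR ?subrr ?(mul0r, mulr0) ?(mul0r, mulr0) ?sqrtr0//; lia.
rewrite (@CG1 _ _ _ _ _ 0 a b 2 0 a.+2 b); try by rewrite /triangle; lia.
rewrite aR -/(dfact k.+1 k) dfact0 wsum02.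
have k0 : 0 <= k%:R :> R by exact: ler0n.
cg_finish.
Qed.

Lemma clebsch_gordan_succ_p1 (l : nat) (m : int) :
  (1 <= l)%N -> `|m| <= l%:Z ->
  clebsch_gordan R l m l.+1 (m - 1) 1 1 =
  Num.sqrt ((l%:R - m%:~R + 1) * (l%:R - m%:~R + 2)
            / ((2 * l%:R + 2) * (2 * l%:R + 3))).
Proof.
move=> l1 ml; have [a [b [aE bE aR bR]]] := weights ml.
rewrite (@CG1 _ _ _ _ _ 2 a b.+2 2 0 a b); try by rewrite /triangle; lia.
rewrite bR -/(dfact l l.+1) dfact2 wsum22.
have l0 : 0 <= l%:R :> R by exact: ler0n.
cg_finish.
Qed.

Lemma clebsch_gordan_pred_0 (l : nat) (m : int) :
  (1 <= l)%N -> `|m| <= l%:Z ->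
  clebsch_gordan R l m l.-1 m 1 0 =
  Num.sqrt ((l%:R + m%:~R) * (l%:R - m%:~R)
            / (l%:R * (2 * l%:R - 1))).
Proof.
move=> l1 ml; have [a [b [aE bE aR bR]]] := weights ml.
case: l l1 {ml} aE bE aR bR => // k _ aE bE aR bR; rewrite [k.+1.-1]/=.
case: a aE aR => [|a] aE aR.
  by rewrite cg_out ?aR ?mul0r ?sqrtr0//; lia.
case: b bE bR => [|b] bE bR.
  by rewrite cg_out ?bR ?mulr0 ?mul0r ?sqrtr0//; lia.
rewrite (@CG1 _ _ _ _ _ 0 a b 1 1 a.+1 b.+1); try by rewrite /triangle; lia.
rewrite aR bR -/(dfact k.+1 k) dfact0 wsum01.
have k0 : 0 <= k%:R :> R by exact: ler0n.
cg_finish.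
Qed.

Lemma clebsch_gordan_succ_0 (l : nat) (m : int) :
  (1 <= l)%N -> `|m| <= l%:Z ->
  clebsch_gordan R l m l.+1 m 1 0 =
  - Num.sqrt ((l%:R - m%:~R + 1) * (l%:R + m%:~R + 1)
              / ((2 * l%:R + 3) * (l%:R + 1))).
Proof.
move=> l1 ml; have [a [b [aE bE aR bR]]] := weights ml.
rewrite (@CG1 _ _ _ _ _ 2 a.+1 b.+1 1 1 a b); try by rewrite /triangle; lia.
rewrite aR bR -/(dfact l l.+1) dfact2 wsum21 mulrN; congr (- _).
have l0 : 0 <= l%:R :> R by exact: ler0n.
cg_finish.
Qed.

Lemma clebsch_gordan_pred_m1 (l : nat) (m : int) :
  (1 <= l)%N -> `|m| <= l%:Z ->
  clebsch_gordan R l m l.-1 (m + 1) 1 (-1) =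
  Num.sqrt ((l%:R - m%:~R) * (l%:R - m%:~R - 1)
            / ((2 * l%:R) * (2 * l%:R - 1))).
Proof.
move=> l1 ml; have [a [b [aE bE aR bR]]] := weights ml.
case: l l1 {ml} aE bE aR bR => // k _ aE bE aR bR; rewrite [k.+1.-1]/=.
case: b bE bR => [|[|b]] bE bR.
- by rewrite cg_out ?bR ?(mul0r, mulr0) ?(mul0r, mulr0) ?sqrtr0//; lia.
- by rewrite cg_out ?bR ?subrr ?(mul0r, mulr0) ?(mul0r, mulr0) ?sqrtr0//; lia.
rewrite (@CG1 _ _ _ _ _ 0 a b 0 2 a b.+2); try by rewrite /triangle; lia.
rewrite bR -/(dfact k.+1 k) dfact0 wsum00.
have k0 : 0 <= k%:R :> R by exact: ler0n.
cg_finish.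
Qed.

Lemma clebsch_gordan_succ_m1 (l : nat) (m : int) :
  (1 <= l)%N -> `|m| <= l%:Z ->
  clebsch_gordan R l m l.+1 (m + 1) 1 (-1) =
  Num.sqrt ((l%:R + m%:~R + 1) * (l%:R + m%:~R + 2)
            / ((2 * l%:R + 3) * (2 * l%:R + 2))).
Proof.
move=> l1 ml; have [a [b [aE bE aR bR]]] := weights ml.
rewrite (@CG1 _ _ _ _ _ 2 a.+2 b 0 2 a b); try by rewrite /triangle; lia.
rewrite aR -/(dfact l l.+1) dfact2 wsum20.
have l0 : 0 <= l%:R :> R by exact: ler0n.
cg_finish.
Qed.

Lemma clebsch_gordan_same_p1 (l : nat) (m : int) :
  (1 <= l)%N -> `|m| <= l%:Z ->
  clebsch_gordan R l m l (m - 1) 1 1 =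
  - Num.sqrt ((l%:R + m%:~R) * (l%:R - m%:~R + 1)
              / (l%:R * (2 * l%:R + 2))).
Proof.
move=> l1 ml; have [a [b [aE bE aR bR]]] := weights ml.
case: a aE aR => [|a] aE aR.
  rewrite cg_out; last by lia.
  by rewrite aR !mul0r sqrtr0 oppr0.
rewrite (@CG1 _ _ _ _ _ 1 a b.+1 2 0 a.+1 b); try by rewrite /triangle; lia.
rewrite aR bR -/(dfact l l) dfact1// wsum12 mulrN; congr (- _).
have l0 : 0 < l%:R :> R by rewrite ltr0n.
cg_finish.
Qed.

Lemma clebsch_gordan_same_m1 (l : nat) (m : int) :
  (1 <= l)%N -> `|m| <= l%:Z ->
  clebsch_gordan R l m l (m + 1) 1 (-1) =
  Num.sqrt ((l%:R + m%:~R + 1) * (l%:R - m%:~R)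
            / (l%:R * (2 * l%:R + 2))).
Proof.
move=> l1 ml; have [a [b [aE bE aR bR]]] := weights ml.
case: b bE bR => [|b] bE bR.
  rewrite cg_out; last by lia.
  by rewrite bR mulr0 mul0r sqrtr0.
rewrite (@CG1 _ _ _ _ _ 1 a.+1 b 0 2 a b.+1); try by rewrite /triangle; lia.
rewrite aR bR -/(dfact l l) dfact1// wsum10.
have l0 : 0 < l%:R :> R by rewrite ltr0n.
cg_finish.
Qed.

Lemma clebsch_gordan_same_0 (l : nat) (m : int) :
  (1 <= l)%N -> `|m| <= l%:Z ->
  clebsch_gordan R l m l m 1 0 =
  m%:~R / Num.sqrt (l%:R * (l%:R + 1)).
Proof.
move=> l1 ml; have [a [b [aE bE aR bR]]] := weights ml.
rewrite (@CG1 _ _ _ _ _ 1 a b 1 1 a b); try by rewrite /triangle; lia.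
rewrite -/(dfact l l) dfact1// wsum11 -aR -bR.
have l0 : 0 < l%:R :> R by rewrite ltr0n.
rewrite (_ : _ - _ = 2 * m%:~R); last by ring.
rewrite [2 * _ / _]mulrAC [_ * m%:~R]mulrC mulrCA; congr (_ * _).
rewrite -sqrtrV; last by rewrite mulr_ge0 ?addr_ge0 ?ler0n.
cg_finish.
Qed.

End Table.

(* The associated Legendre function P_l^m, with the Condon-Shortley phase. *)
Definition legendre (R : realType) (l m : nat) (t : R) : R :=
  (-1) ^+ m / (2 ^+ l * l`!%:R) * Num.sqrt (1 - t ^+ 2) ^+ m
  * derive1n (l + m) (fun s : R => (s ^+ 2 - 1) ^+ l) t.

Definition expi (R : realType) (t : R) : R[i] := (cos t)%:C + 'i * (sin t)%:C.

Definition sph_harm_nat (R : realType) (l m : nat) (x : 'cV[R]_3) : R[i] :=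
  (Num.sqrt ((2 * l + 1)%:R / (4 * pi) * ((l - m)`!%:R / (l + m)`!%:R))
   * legendre l m (cos (colatitude x)))%:C
  * expi (m%:R * azimuth x).

Definition sph_harm (R : realType) (l : nat) (m : int) (x : 'cV[R]_3) : R[i] :=
  if `|m| <= l%:Z then
    match m with
    | Posz n => sph_harm_nat l n x
    | Negz n => (-1) ^+ n.+1 * (sph_harm_nat l n.+1 x)^*
    end
  else 0.

Definition coef_c (R : realType) (l : nat) : R :=
  Num.sqrt ((l + 1)%:R / (2 * l + 1)%:R).
Definition coef_d (R : realType) (l : nat) : R :=
  Num.sqrt (l%:R / (2 * l + 1)%:R).

Section VectorHarmonics.
Variable R : realType.
Local Notation C := (clebsch_gordan R).
Local Notation c := (coef_c R).
Local Notation d := (coef_d R).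
Local Notation Y := (@sph_harm R).

(* For [l >= 1]; the natural-number predecessor [l.-1] is then [l - 1]. *)
Definition B_p1 (l : nat) (m : int) (x : 'cV[R]_3) : R[i] :=
  (c l * C l m l.-1 (m - 1) 1 1)%:C * Y l.-1 (m - 1) x
  + (d l * C l m l.+1 (m - 1) 1 1)%:C * Y l.+1 (m - 1) x.

Definition B_0 (l : nat) (m : int) (x : 'cV[R]_3) : R[i] :=
  (c l * C l m l.-1 m 1 0)%:C * Y l.-1 m x
  + (d l * C l m l.+1 m 1 0)%:C * Y l.+1 m x.

Definition B_m1 (l : nat) (m : int) (x : 'cV[R]_3) : R[i] :=
  (c l * C l m l.-1 (m + 1) 1 (-1))%:C * Y l.-1 (m + 1) x
  + (d l * C l m l.+1 (m + 1) 1 (-1))%:C * Y l.+1 (m + 1) x.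

Definition D_p1 (l : nat) (m : int) (x : 'cV[R]_3) : R[i] :=
  'i * (C l m l (m - 1) 1 1)%:C * Y l (m - 1) x.

Definition D_0 (l : nat) (m : int) (x : 'cV[R]_3) : R[i] :=
  'i * (C l m l m 1 0)%:C * Y l m x.

Definition D_m1 (l : nat) (m : int) (x : 'cV[R]_3) : R[i] :=
  'i * (C l m l (m + 1) 1 (-1))%:C * Y l (m + 1) x.

Definition inv_sqrt2 : R[i] := ((Num.sqrt 2)^-1 : R)%:C.

Definition vsh_y (l : nat) (m : int) (x : 'cV[R]_3) : 'cV[R[i]]_3 :=
  col3 (- inv_sqrt2 * (B_p1 l m x - B_m1 l m x))
       (- inv_sqrt2 * 'i * (B_p1 l m x + B_m1 l m x))
       (B_0 l m x).

Definition vsh_z (l : nat) (m : int) (x : 'cV[R]_3) : 'cV[R[i]]_3 :=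
  col3 (- inv_sqrt2 * (D_p1 l m x - D_m1 l m x))
       (- inv_sqrt2 * 'i * (D_p1 l m x + D_m1 l m x))
       (D_0 l m x).

Section Transforms.
Variables (N : nat) (Q : quadrature R N).

Definition scalar_transform (l : nat) (m : int) (f : 'I_N -> R) : R[i] :=
  \sum_(k < N) (weight Q k)%:C * (f k)%:C * (Y l m (node Q k))^*.

(* [(v^t* *m w) 0 0] is the only entry of the 1 x 1 matrix v^* w. *)
Definition vector_transform (v : 'cV[R]_3 -> 'cV[R[i]]_3)
    (T : 'I_N -> 'cV[R]_3) : R[i] :=
  \sum_(k < N) (weight Q k)%:C
    * ((v (node Q k))^t* *m map_mx (real_complex R) (T k)) 0 0.

Definition vsh_y_transform (l : nat) (m : int) :=
  vector_transform (vsh_y l m).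
Definition vsh_z_transform (l : nat) (m : int) :=
  vector_transform (vsh_z l m).

End Transforms.

(* [xi2], [xi4] and [xi6] are meant for [l >= 1]. *)
Definition xi1 (l : nat) (m : int) : R := c l.+1 * C l.+1 (m + 1) l m 1 1.
Definition xi2 (l : nat) (m : int) : R := d l.-1 * C l.-1 (m + 1) l m 1 1.
Definition xi3 (l : nat) (m : int) : R := c l.+1 * C l.+1 (m - 1) l m 1 (-1).
Definition xi4 (l : nat) (m : int) : R := d l.-1 * C l.-1 (m - 1) l m 1 (-1).
Definition xi5 (l : nat) (m : int) : R := c l.+1 * C l.+1 m l m 1 0.
Definition xi6 (l : nat) (m : int) : R := d l.-1 * C l.-1 m l m 1 0.

Definition mu1 (l : nat) (m : int) : R := C l (m + 1) l m 1 1.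
Definition mu2 (l : nat) (m : int) : R := C l m l m 1 0.
Definition mu3 (l : nat) (m : int) : R := C l (m - 1) l m 1 (-1).

End VectorHarmonics.

(* Main.v *)
Require Import Defs.
From mathcomp Require Import all_boot all_order all_algebra.
From mathcomp Require Import all_classical all_reals all_analysis.
From mathcomp Require Import complex.
From mathcomp Require Import ring.

(** Why it holds.  Both vector harmonics have the same shape: Cartesian
    components [- (p - q) / sqrt 2], [- i (p + q) / sqrt 2] and [r] built from
    three spherical components [p, q, r] of weight 1, -1 and 0.  Conjugating
    and pairing with a real vector [T] regroups the Cartesian components as
    [(p^* (- T1 + i T2) + q^* (T1 + i T2)) / sqrt 2 + r^* T3]; summed against the
    quadrature weights, this is [vector_transform_cartesian].  Each of [p, q, r]
    is a real (for y) or imaginary (for z) combination of one or two scalar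
    harmonics, and the discrete pairing [sampled_dot] is conjugate-linear in the
    harmonic, so the sums become scalar transforms with conjugated coefficients;
    the conjugate of the factor i of z is the source of the sign in front of its
    transform.  The coefficients xi and mu are those of y and z with the degree
    and order shifted so as to be read at the indices of the scalar harmonic. *)

Import Order.TTheory GRing.Theory Num.Theory.

Local Open Scope complex_scope.
Local Open Scope sesquilinear_scope.
Local Open Scope ring_scope.

Lemma conj_real_complex {R : realType} (a : R) : (a%:C)^* = a%:C.
Proof. exact: conjc_real. Qed.

(** The scalar transform with an arbitrary function in place of the harmonic;
    conjugate-linearity in [g] can only be stated at this generality. *)
Definition sampled_dot {R : realType} {N : nat} (Q : quadrature R N)
    (g : 'cV[R]_3 -> R[i]) (f : 'I_N -> R) : R[i] :=
  \sum_(k < N) (weight Q k)%:C * (f k)%:C * (g (node Q k))^*.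

Lemma sampled_dotZ {R : realType} {N : nat} (Q : quadrature R N)
    (a : R[i]) (g : 'cV[R]_3 -> R[i]) (f : 'I_N -> R) :
  sampled_dot Q (fun x => a * g x) f = a^* * sampled_dot Q g f.
Proof.
by rewrite /sampled_dot mulr_sumr; apply: eq_bigr => k _; rewrite rmorphM mulrCA.
Qed.

Lemma sampled_dotD {R : realType} {N : nat} (Q : quadrature R N)
    (g h : 'cV[R]_3 -> R[i]) (f : 'I_N -> R) :
  sampled_dot Q (fun x => g x + h x) f = sampled_dot Q g f + sampled_dot Q h f.
Proof.
by rewrite /sampled_dot -big_split; apply: eq_bigr => k _; rewrite rmorphD mulrDr.
Qed.

(** Cartesian components of the vector whose spherical components, of
    weight 1, -1 and 0, are [p], [q] and [r]. *)
Definition cartesian {R : realType} (p q r : R[i]) : 'cV[R[i]]_3 :=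
  col3 (- inv_sqrt2 R * (p - q)) (- inv_sqrt2 R * 'i * (p + q)) r.

Lemma cartesian_adjoint_mul {R : realType} (p q r : R[i]) (t : 'cV[R]_3) :
  ((cartesian p q r)^t* *m map_mx (real_complex R) t) 0 0 =
    inv_sqrt2 R * (p^* * (- (t 0 0)%:C + 'i * (t 1 0)%:C)
                   + q^* * ((t 0 0)%:C + 'i * (t 1 0)%:C))
    + r^* * (t 2 0)%:C.
Proof.
rewrite mxE !big_ord_recl big_ord0 addr0 !mxE.
have -> : lift ord0 (ord0 : 'I_2) = 1 by apply/val_inj.
have -> : lift ord0 (lift ord0 (ord0 : 'I_1)) = 2 :> 'I_3 by apply/val_inj.
have -> : ord0 = 0 :> 'I_3 by [].
rewrite !(tnth_nth 0) /=.
rewrite !(rmorphM, rmorphN, rmorphB, rmorphD) /= conjCi conj_real_complex.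
by ring.
Qed.

(** The pairing with [- T1 + i T2] and [T1 + i T2] is kept expanded in terms of
    the real sequences, since scalar transforms are taken of real data. *)
Lemma vector_transform_cartesian {R : realType} {N : nat} (Q : quadrature R N)
    (p q r : 'cV[R]_3 -> R[i]) (T : 'I_N -> 'cV[R]_3) :
  let S := sampled_dot Q in
  let T1 := fun k => T k 0 0 in
  let T2 := fun k => T k 1 0 in
  let T3 := fun k => T k 2 0 in
  vector_transform Q (fun x => cartesian (p x) (q x) (r x)) T =
    inv_sqrt2 R * (- S p T1 + 'i * S p T2 + (S q T1 + 'i * S q T2)) + S r T3.
Proof.
move=> S T1 T2 T3; rewrite /S /sampled_dot -sumrN !mulr_sumr -!big_split /=.
rewrite mulr_sumr -big_split; apply: eq_bigr => k _ /=.
rewrite cartesian_adjoint_mul; ring.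
Qed.

Theorem theorem4p2 (R : realType) (N : nat) (hN : (2 <= N)%N)
    (T : 'I_N -> 'cV[R]_3) (Q : quadrature R N) (l : nat) (m : int)
    (hl : (1 <= l)%N) (hm : - l%:Z <= m <= l%:Z) :
  let F := scalar_transform Q in
  let T1 := fun k => T k 0 0 in
  let T2 := fun k => T k 1 0 in
  let T3 := fun k => T k 2 0 in
  vsh_y_transform Q l m T =
    inv_sqrt2 R *
      ((xi1 R l.-1 (m - 1))%:C
         * (- F l.-1 (m - 1) T1 + 'i * F l.-1 (m - 1) T2)
       + (xi2 R l.+1 (m - 1))%:C
         * (- F l.+1 (m - 1) T1 + 'i * F l.+1 (m - 1) T2)
       + (xi3 R l.-1 (m + 1))%:C
         * (F l.-1 (m + 1) T1 + 'i * F l.-1 (m + 1) T2)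
       + (xi4 R l.+1 (m + 1))%:C
         * (F l.+1 (m + 1) T1 + 'i * F l.+1 (m + 1) T2))
    + (xi5 R l.-1 m)%:C * F l.-1 m T3
    + (xi6 R l.+1 m)%:C * F l.+1 m T3
  /\
  vsh_z_transform Q l m T =
    - inv_sqrt2 R * 'i *
      ((mu1 R l (m - 1))%:C * (- F l (m - 1) T1 + 'i * F l (m - 1) T2)
       + (mu3 R l (m + 1))%:C * (F l (m + 1) T1 + 'i * F l (m + 1) T2))
    - 'i * (mu2 R l m)%:C * F l m T3.
Proof.
move=> F T1 T2 T3.
have FE j n f : sampled_dot Q (sph_harm j n) f = F j n f by [].
split.
- rewrite /vsh_y_transform (vector_transform_cartesian _ (B_p1 l m)) -/T1 -/T2 -/T3.
  rewrite /B_p1 /B_m1 /B_0 !sampled_dotD !sampled_dotZ !conj_real_complex.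
  (* Undoing the index shifts, [l.-1.+1 = l] being where [1 <= l] enters. *)
  rewrite /xi1 /xi2 /xi3 /xi4 /xi5 /xi6 prednK// subrK addrK /=.
  rewrite !FE; ring.
- rewrite /vsh_z_transform (vector_transform_cartesian _ (D_p1 l m)) -/T1 -/T2 -/T3.
  rewrite /D_p1 /D_m1 /D_0 !sampled_dotZ !rmorphM /= !conjCi !conj_real_complex.
  rewrite /mu1 /mu2 /mu3 subrK addrK.
  rewrite !FE; ring.
Qed.
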